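(* Let $\beta\in[0,2)$ and $\alpha\in[0,1]$. For any random variable $X$ with $\mathbb{E}[X]=0$, $\mathbb{E}[X^2]>0$ and $\mathbb{E}[X^4]<\infty$, $$\frac{\mathbb{E}[X^4]}{|\mathbb{E}[X^2]|^2}-\alpha\,\frac{|\mathbb{E}[X^3]|^2}{|\mathbb{E}[X^2]|^3}-(1-\alpha)\,\frac{|\mathbb{E}[X^2]|^{\beta/(2-\beta)}}{|\mathbb{E}[|X|^\beta]|^{2/(2-\beta)}}\;\geq\;\alpha.$$ The equality is attained if and only if $X$ is symmetrically Bernoulli.
   Context: A random variable $X$ is called Bernoulli if the support of $X$ consists of two points. It is called symmetrically Bernoulli if it is Bernoulli and its skewness is $0$, that is, $\mathbb{E}[(X-\mathbb{E}[X])^3]=0$.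
   Formalization: ''Equality only if X is symmetrically Bernoulli'' is claimed only for 0<α<1 or α=β=0; it is false for α=1 (any centered Bernoulli X gives equality) and for α=0<β (X=±1 with probability p/2 each, else 0); at β=0, |X|^0 is read as 1. *)

(* Defs.v *)
From mathcomp Require Import all_boot all_order all_algebra.
From mathcomp Require Import all_classical all_reals all_analysis.

Set Implicit Arguments.
Unset Strict Implicit.
Unset Printing Implicit Defensive.

Import Order.TTheory GRing.Theory Num.Theory.
Import numFieldNormedType.Exports.

Local Open Scope classical_set_scope.
Local Open Scope ring_scope.

(* Topological support of the law of X: X need not take all, or only, these
   values pointwise. *)
Definition rv_support (d : measure_display) (T : measurableType d)
    (R : realType) (P : probability T R) (X : {RV P >-> R}) : set R :=
  [set x | forall U : set R, open U -> U x -> (0 < distribution P X U)%E].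

Definition bernoulli_rv (d : measure_display) (T : measurableType d)
    (R : realType) (P : probability T R) (X : {RV P >-> R}) : Prop :=
  exists a b : R, a != b /\ rv_support X = [set a; b].

Definition symmetric_bernoulli_rv (d : measure_display) (T : measurableType d)
    (R : realType) (P : probability T R) (X : {RV P >-> R}) : Prop :=
  bernoulli_rv X /\
  ('E_P[fun t => ((X t - fine 'E_P[X]) ^+ 3)%R] = 0)%E.

(* [fine] discards nothing when E[X^4] is finite, since every moment below then
   is. The real power satisfies a `^ 0 = 1 for all a, so that E[|X|^0] = 1 even
   if X vanishes with positive probability. *)
Definition moment_gap (d : measure_display) (T : measurableType d)
    (R : realType) (P : probability T R) (X : {RV P >-> R})
    (alpha beta : R) : R :=
  let m2 := fine 'E_P[fun t => (X t ^+ 2)%R] in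
  let m3 := fine 'E_P[fun t => (X t ^+ 3)%R] in
  let m4 := fine 'E_P[fun t => (X t ^+ 4)%R] in
  let mbeta := fine 'E_P[fun t => (`|X t| `^ beta)%R] in
  m4 / `|m2| ^+ 2
  - alpha * (`|m3| ^+ 2 / `|m2| ^+ 3)
  - (1 - alpha) *
      (`|m2| `^ (beta / (2 - beta)) / `|mbeta| `^ (2 / (2 - beta))).

(* Main.v *)
Require Import Defs.
From mathcomp Require Import all_boot all_order all_algebra.
From mathcomp Require Import all_classical all_reals all_analysis.
From mathcomp Require Import measurable_realfun ring lra.

Import Order.TTheory GRing.Theory Num.Theory.
Import numFieldNormedType.Exports.

Local Open Scope classical_set_scope.
Local Open Scope ring_scope.

(** Write m_k = E[X^k], m_b = E[|X|^b] and k = m_4 / m_2^2. The difference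
    between the two sides of the inequality is the convex combination

      alpha (k - m_3^2 / m_2^3 - 1) + (1 - alpha) (k - L),
      L = m_2^(b/(2-b)) / m_b^(2/(2-b)),

    and each bracket is nonnegative.

    The first bracket is Pearson's inequality: m_2^2 times it is the mean of the
    square (X^2 - (m_3/m_2) X - m_2)^2 ([skewness_le_kurtosis]).

    The second bracket is Lyapunov's interpolation of m_2 between m_b and m_4.
    It is derived from the pointwise inequality
    (4 - b) t^2 <= 2 t^b + (2 - b) t^4 for t >= 0, which is strict at every
    positive t other than 1 ([power_gap_gt0]). Taking t = |X| / c and integrating
    gives, for the scale c^2 = m_4 / m_2 at which the t^2 and t^4 terms have equal
    means, m_2 <= c^(2-b) m_b ([lyapunov]); raising to the power 2/(2-b) gives
    L <= k ([moment_ratio_le]). Going through a pointwise inequality rather than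
    through Hoelder's inequality keeps track of the case of equality: the
    integrand must vanish almost everywhere, so |X| is almost surely 0 or c, and
    the value 0 is possible only if b is nonzero since t^0 = 1
    ([moment_ratio_eq_ae]).

    If the whole expression is 0 and alpha < 1, then L = k. For b = 0 this gives
    X^2 = c^2 almost surely. For alpha > 0 the first bracket vanishes too, so X is
    almost surely a root of x^2 - (m_3/m_2) x - m_2; as m_2 > 0 this excludes
    the value 0, and again X^2 = c^2 almost surely. Conversely X^2 = m_2 almost
    surely makes every moment explicit.

    It remains to see that, for centered X, being symmetrically Bernoulli means
    X^2 = m_2 almost surely. A random variable lies almost surely in its support
    ([ae_rv_support]). If the support is {a, b}, the relation (X-a)(X-b) = 0 and
    X times it have means m_2 + ab = 0 and m_3 - (a+b) m_2 = 0, so that zero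
    skewness forces b = -a and a^2 = m_2. In the other direction X is almost surely
    one of the two square roots of m_2, and it cannot be almost surely equal to
    only one of them because its mean is 0. *)

(** * A pointwise inequality between the powers b, 2 and 4 *)

Section power_gap.
Context {R : realType}.
Implicit Types b t : R.

Definition power_gap b t := 2 * t `^ b + (2 - b) * t ^+ 4 - (4 - b) * t ^+ 2.

(** With v = ln t, dividing by t^2 leaves
    2 exp((b-2) v) + (2-b) exp(2 v) - (4-b), and the tangent lines at v = 0 of
    the two exponentials add up to exactly 4 - b. *)
Lemma power_gap_gt0 b t : b < 2 -> 0 < t -> t != 1 -> 0 < power_gap b t.
Proof.
move=> b2 t0 t1; set v := ln t.
have v0 : v != 0 by rewrite ln_eq0.
have tb : t `^ b = t ^+ 2 * expR ((b - 2) * v).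
  rewrite -powR_mulrn ?ltW// /powR gt_eqF// -expRD; congr expR.
  by rewrite -/v; ring.
have t2 : t ^+ 2 = expR (2 * v).
  by rewrite -powR_mulrn ?ltW// /powR gt_eqF.
rewrite /power_gap tb.
have -> : 2 * (t ^+ 2 * expR ((b - 2) * v)) + (2 - b) * t ^+ 4 - (4 - b) * t ^+ 2
  = t ^+ 2 * (2 * expR ((b - 2) * v) + (2 - b) * t ^+ 2 - (4 - b)) by ring.
apply: mulr_gt0; first exact: exprn_gt0.
rewrite t2.
have e1 : 1 + (b - 2) * v < expR ((b - 2) * v).
  by apply: expR_gt1Dx; rewrite mulf_neq0// subr_eq0 lt_eqF.
have e2 : 1 + 2 * v < expR (2 * v) by apply: expR_gt1Dx; rewrite mulf_neq0.
have : (2 - b) * (1 + 2 * v) < (2 - b) * expR (2 * v).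
  by rewrite ltr_pM2l// subr_gt0.
lra.
Qed.

Lemma power_gap_ge0 b t : b < 2 -> 0 <= t -> 0 <= power_gap b t.
Proof.
move=> b2; rewrite le_eqVlt => /predU1P[<-|t0].
  by rewrite /power_gap !expr0n/= !mulr0 subr0 addr0 mulr_ge0// powR_ge0.
have [->|t1] := eqVneq t 1; last by rewrite ltW// power_gap_gt0.
rewrite /power_gap powR1 !expr1n; lra.
Qed.

End power_gap.

(** * Real-valued integrals against a probability *)

Section real_integral.
Context {d} {T : measurableType d} {R : realType} {P : probability T R}.
Implicit Types f g : T -> R.

Lemma fine_expectation f : fine 'E_P[f] = \int[P]_t f t.
Proof. by rewrite unlock. Qed.

Lemma ae_eq_Rintegral f g :
  measurable_fun setT f -> measurable_fun setT g ->
  {ae P, forall t, f t = g t} -> \int[P]_t f t = \int[P]_t g t.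
Proof.
move=> mf mg fg; congr fine; apply: ae_eq_integral => //.
- exact/measurable_EFinP.
- exact/measurable_EFinP.
- by apply: filterS fg => t /= -> _.
Qed.

Lemma Rintegral_eq0_ae f : P.-integrable setT (EFin \o f) ->
  (forall t, 0 <= f t) -> \int[P]_t f t = 0 -> {ae P, forall t, f t = 0}.
Proof.
move=> intf f0 If0.
have mf : measurable_fun setT (EFin \o f) by case/integrableP : intf.
have : (\int[P]_t `|(EFin \o f) t|)%E = 0%E.
  under eq_integral do rewrite /= ger0_norm//.
  rewrite -[LHS]fineK; last exact: integrable_fin_num.
  by move: If0; rewrite /Rintegral => ->.
move/(ae_eq_integral_abs P measurableT mf).
by apply: filterS => t /(_ I) [].
Qed.

Lemma Rintegral_probability_cst (c : R) : \int[P]_t c = c.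
Proof. by rewrite Rintegral_cst//= probability_setT mulr1. Qed.

End real_integral.

(** * The support of a real random variable *)

Section support.
Context {d} {T : measurableType d} {R : realType} {P : probability T R}.
Variable X : {RV P >-> R}.

Lemma distribution_eq0_ae (U : set R) : open U ->
  distribution P X U = 0%E <-> {ae P, forall t, ~ U (X t)}.
Proof.
move=> oU.
have mU : measurable (X @^-1` U).
  by apply: measurable_funPTI => //; exact: open_measurable.
have -> : distribution P X U = P (X @^-1` U) by [].
rewrite -(negligibleP P mU) -[X in P.-negligible X]setCK.
by [].
Qed.

Lemma notin_rv_support (x : R) : ~ rv_support X x <->
  exists U : set R, [/\ open U, U x & {ae P, forall t, ~ U (X t)}].
Proof.
split=> [/existsNP[U /not_implyP[oU /not_implyP[Ux /negP]]]|[U [oU Ux XU]]].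
  rewrite -leNgt => PU; exists U; split=> //; apply/distribution_eq0_ae => //.
  by apply/eqP; rewrite eq_le PU/=.
by move=> /(_ U oU Ux); move/distribution_eq0_ae : XU => ->//; rewrite ltxx.
Qed.

(** The complement of the support is covered by the countably many intervals with
    rational endpoints that the law of X does not charge. *)
Lemma ae_rv_support : {ae P, forall t, rv_support X (X t)}.
Proof.
(* [I] enumerates the intervals with rational endpoints; indices that encode no
   pair are sent to the empty set. *)
pose I (k : nat) : set R :=
  if (unpickle k : option (rat * rat)) is Some (p, q)
  then `]ratr p, ratr q[%classic else set0.
have : {ae P, forall t, forall k,
    {ae P, forall s, ~ I k (X s)} -> ~ I k (X t)}.
  apply: ae_foralln => k.
  have [Ik|nIk] := pselect {ae P, forall s, ~ I k (X s)}.
    by apply: filterS Ik => t Ikt _.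
  exact: aeW.
apply: filterS => t It; apply: contrapT => /notin_rv_support[U [oU UX XU]].
have : nbhs (X t) U by apply: open_nbhs_nbhs.
rewrite -nbhs_ballE => -[e /= e0 eU].
have /rat_in_itvoo[p] : X t - e < X t by rewrite ltrBlDr ltrDl.
rewrite in_itv/= => /andP[p1 p2].
have /rat_in_itvoo[q] : X t < X t + e by rewrite ltrDl.
rewrite in_itv/= => /andP[q1 q2].
have IE : I (pickle (p, q)) = `]ratr p, ratr q[%classic.
  by rewrite /I pickleK.
apply: (It (pickle (p, q))); rewrite IE/=; last by rewrite in_itv/= p2 q1.
apply: filterS XU => s nU; rewrite in_itv/= => /andP[ps sq]; apply: nU.
apply: eU; rewrite /ball/= ltr_norml; apply/andP; split; lra.
Qed.

End support.

(** * Integrating polynomials of degree at most four *)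

Section fourth_moment.
Context {d} {T : measurableType d} {R : realType} {P : probability T R}.
Variable X : {RV P >-> R}.
Hypothesis EX4 : ('E_P[fun t => (X t ^+ 4)%R] < +oo)%E.

Local Notation m k := (\int[P]_t (X t ^+ k)).

(** Every moment identity below is the mean of a polynomial of degree at most 4 in
    X; a fixed five-coefficient form lets one lemma integrate all of them. *)
Definition quartic (a4 a3 a2 a1 a0 x : R) :=
  a4 * x ^+ 4 + a3 * x ^+ 3 + a2 * x ^+ 2 + a1 * x + a0.

Let measurable_expn k : measurable_fun setT (fun t => X t ^+ k).
Proof. exact: measurable_funX. Qed.

Let integrable_fourth : P.-integrable setT (fun t => (X t ^+ 4)%:E).
Proof.
apply/integrableP; split; first exact/measurable_EFinP.
under eq_integral do rewrite /= ger0_norm ?exprn_even_ge0//.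
by move: EX4; rewrite unlock.
Qed.

Lemma integrable_le_fourth (f : T -> R) : measurable_fun setT f ->
  (forall t, `|f t| <= 1 + X t ^+ 4) -> P.-integrable setT (EFin \o f).
Proof.
move=> mf fle.
have i1 : P.-integrable setT (EFin \o (cst 1 : T -> R)).
  exact: finite_measure_integrable_cst.
apply: (le_integrable measurableT _ _ (integrableD measurableT i1 integrable_fourth)).
  exact/measurable_EFinP.
move=> t _ /=; rewrite lee_fin.
by rewrite (le_trans (fle t))// ler_norm.
Qed.

Let integrable_expn k : (k <= 4)%N -> P.-integrable setT (fun t => (X t ^+ k)%:E).
Proof.
move=> k4; apply: integrable_le_fourth => // t; rewrite normrX.
have -> : X t ^+ 4 = `|X t| ^+ 4 by rewrite -normrX ger0_norm// exprn_even_ge0.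
have [x1|/ltW x1] := leP `|X t| 1.
  by rewrite (le_trans (exprn_ile1 _ (normr_ge0 _) x1))// lerDl.
by rewrite (le_trans (ler_weXn2l x1 k4))// lerDr.
Qed.

Let integrable_monomial k (a : R) : (k <= 4)%N ->
  P.-integrable setT (EFin \o (fun t => a * X t ^+ k)).
Proof.
move=> k4; have := integrableZl measurableT a (integrable_expn _ k4).
by apply: eq_integrable => // t _; rewrite /= EFinM.
Qed.

Let integrableD_EFin (f g : T -> R) : P.-integrable setT (EFin \o f) ->
  P.-integrable setT (EFin \o g) ->
  P.-integrable setT (EFin \o (fun t => f t + g t)).
Proof. by move=> intf intg; exact: (integrableD measurableT intf intg). Qed.

Let quartic_Rintegral a4 a3 a2 a1 a0 :
  P.-integrable setT (EFin \o (fun t => quartic a4 a3 a2 a1 a0 (X t))) /\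
  \int[P]_t quartic a4 a3 a2 a1 a0 (X t) =
  a4 * m 4 + a3 * m 3 + a2 * m 2 + a1 * m 1 + a0.
Proof.
have i0 : P.-integrable setT (EFin \o (fun=> a0 : R)).
  exact: finite_measure_integrable_cst.
have i4 := @integrable_monomial 4 a4 isT.
have i3 := integrableD_EFin _ _ i4 (@integrable_monomial 3 a3 isT).
have i2 := integrableD_EFin _ _ i3 (@integrable_monomial 2 a2 isT).
have i1 := integrableD_EFin _ _ i2 (@integrable_monomial 1 a1 isT).
split; first exact: (integrableD_EFin _ _ i1 i0).
rewrite /quartic RintegralD// Rintegral_probability_cst RintegralD//; last first.
  exact: (@integrable_monomial 1 a1 isT).
do 2! (rewrite RintegralD//; last exact: integrable_monomial).
rewrite !RintegralZl//; try exact: integrable_expn.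
exact: (integrable_expn 1%N (isT : (1 <= 4)%N)).
Qed.

Lemma integrable_quartic a4 a3 a2 a1 a0 :
  P.-integrable setT (EFin \o (fun t => quartic a4 a3 a2 a1 a0 (X t))).
Proof. by have [] := quartic_Rintegral a4 a3 a2 a1 a0. Qed.

Lemma Rintegral_quartic a4 a3 a2 a1 a0 :
  \int[P]_t quartic a4 a3 a2 a1 a0 (X t) =
  a4 * m 4 + a3 * m 3 + a2 * m 2 + a1 * m 1 + a0.
Proof. by have [] := quartic_Rintegral a4 a3 a2 a1 a0. Qed.

Lemma ae_quartic_eq0 a4 a3 a2 a1 a0 :
  {ae P, forall t, quartic a4 a3 a2 a1 a0 (X t) = 0} ->
  a4 * m 4 + a3 * m 3 + a2 * m 2 + a1 * m 1 + a0 = 0.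
Proof.
move=> q0; rewrite -Rintegral_quartic -[RHS](@Rintegral_probability_cst _ _ _ P).
apply: ae_eq_Rintegral => //.
by have /integrableP[/measurable_EFinP] := integrable_quartic a4 a3 a2 a1 a0.
Qed.

Lemma integrable_absolute_moment (b : R) : 0 <= b -> b < 2 ->
  P.-integrable setT (EFin \o (fun t => `|X t| `^ b)).
Proof.
move=> b0 b2; apply: integrable_le_fourth.
  apply: (measurableT_comp (measurable_powR b)).
  exact: measurableT_comp.
move=> t; rewrite ger0_norm ?powR_ge0//.
have -> : X t ^+ 4 = `|X t| ^+ 4 by rewrite -normrX ger0_norm// exprn_even_ge0.
have [x1|/ltW x1] := leP `|X t| 1.
  rewrite (@le_trans _ _ 1) ?lerDl ?exprn_ge0//.
  by have := ge0_ler_powR b0 _ _ x1; rewrite powR1 !nnegrE; exact.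
rewrite (@le_trans _ _ (`|X t| ^+ 4)) ?lerDr//.
rewrite -powR_mulrn// ler_powR//; lra.
Qed.

Lemma Rintegral_power_gap (b c : R) : 0 <= b -> b < 2 -> 0 < c ->
  \int[P]_t power_gap b (`|X t| / c) =
  2 * ((c `^ b)^-1 * \int[P]_t (`|X t| `^ b)) + (2 - b) * (c ^- 4 * m 4)
  - (4 - b) * (c ^- 2 * m 2) /\
  P.-integrable setT (EFin \o (fun t => power_gap b (`|X t| / c))).
Proof.
move=> b0 b2 c0.
have E t : power_gap b (`|X t| / c) = 2 * (c `^ b)^-1 * `|X t| `^ b +
    quartic ((2 - b) * c ^- 4) 0 (- (4 - b) * c ^- 2) 0 0 (X t).
  rewrite /power_gap /quartic powRM// ?invr_ge0 1?ltW//.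
  rewrite -powR_inv1 1?ltW// powRAC powR_inv1 ?powR_ge0//.
  rewrite powR_inv1 1?ltW// !expr_div_n -!normrX.
  rewrite (ger0_norm (exprn_even_ge0 _ _))// (ger0_norm (exprn_even_ge0 _ _))//.
  ring.
have iq := integrable_quartic ((2 - b) * c ^- 4) 0 (- (4 - b) * c ^- 2) 0 0.
have ib := integrable_absolute_moment _ b0 b2.
have iZ := integrableZl measurableT (2 * (c `^ b)^-1) ib.
under eq_Rintegral do rewrite E.
under [X in EFin \o X]eq_fun do rewrite E.
split; last exact: (integrableD measurableT iZ iq).
rewrite RintegralD// RintegralZl// Rintegral_quartic; ring.
Qed.

End fourth_moment.

(** * Pearson's and Lyapunov's inequalities for a centered variable *)

(** Puts the two sides of L <= m_4 / m_2^2 over the common denominator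
    s mb^(2/(2-b)), where k^2 stands for m_4 / m_2. The numerators are then the
    images of the two sides of s <= k^(2-b) mb under the increasing function
    x^(2/(2-b)), which transfers both the inequality and its case of equality. *)
Lemma lyapunov_ratioE (R : realType) (b s k mb : R) : b < 2 ->
  0 < s -> 0 < k -> 0 < mb ->
  s `^ (b / (2 - b)) / mb `^ (2 / (2 - b)) =
    (s `^ (2 / (2 - b))) / (s * mb `^ (2 / (2 - b))) /\
  k ^+ 2 / s = (k `^ (2 - b) * mb) `^ (2 / (2 - b)) / (s * mb `^ (2 / (2 - b))).
Proof.
move=> b2 s0 k0 mb0.
have b20 : 2 - b != 0 by rewrite subr_eq0 gt_eqF.
have mbr : mb `^ (2 / (2 - b)) != 0 by rewrite gt_eqF// powR_gt0.
split.
  have -> : s `^ (2 / (2 - b)) = s * s `^ (b / (2 - b)).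
    have -> : 2 / (2 - b) = 1 + b / (2 - b) by field.
    by rewrite powRD ?(gt_eqF s0) ?implybT// powRr1// ltW.
  by field; rewrite mbr gt_eqF.
rewrite powRM ?powR_ge0 ?ltW// -powRrM mulrCA divff// mulr1.
rewrite powR_mulrn ?ltW//.
by field; rewrite mbr gt_eqF.
Qed.

Section centered.
Context {d} {T : measurableType d} {R : realType} {P : probability T R}.
Variable X : {RV P >-> R}.
Hypothesis EX4 : ('E_P[fun t => (X t ^+ 4)%R] < +oo)%E.

Local Notation m k := (\int[P]_t (X t ^+ k)).
Local Notation mabs b := (\int[P]_t (`|X t| `^ b)).

Hypothesis m1 : m 1 = 0.
Hypothesis m2_gt0 : 0 < m 2.

(* The expansion of (x^2 - k x - m_2)^2, in the form that can be integrated. *)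
Let pearson k x := quartic 1 (- 2 * k) (k ^+ 2 - 2 * m 2) (2 * m 2 * k) (m 2 ^+ 2) x.

Let pearsonE k x : pearson k x = (x ^+ 2 - k * x - m 2) ^+ 2.
Proof. by rewrite /pearson /quartic; ring. Qed.

Let Rintegral_pearson :
  \int[P]_t pearson (m 3 / m 2) (X t) = m 4 - m 2 ^+ 2 - m 3 ^+ 2 / m 2.
Proof.
rewrite (Rintegral_quartic X EX4) m1; field.
by rewrite gt_eqF.
Qed.

Lemma skewness_le_kurtosis : m 2 ^+ 2 + m 3 ^+ 2 / m 2 <= m 4.
Proof.
rewrite -subr_ge0 opprD addrA -Rintegral_pearson; apply: Rintegral_ge0 => t _.
by rewrite pearsonE sqr_ge0.
Qed.

Lemma skewness_eq_kurtosis_ae : m 4 = m 2 ^+ 2 + m 3 ^+ 2 / m 2 ->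
  {ae P, forall t, X t ^+ 2 - m 3 / m 2 * X t - m 2 = 0}.
Proof.
move=> e; have : {ae P, forall t, pearson (m 3 / m 2) (X t) = 0}.
  apply: Rintegral_eq0_ae.
  - exact: integrable_quartic.
  - by move=> t; rewrite pearsonE sqr_ge0.
  - by rewrite Rintegral_pearson e; ring.
by apply: filterS => t; rewrite pearsonE => /eqP; rewrite sqrf_eq0 => /eqP.
Qed.

Lemma fourth_moment_gt0 : 0 < m 4.
Proof.
apply: (lt_le_trans _ skewness_le_kurtosis); apply: ltr_pwDl.
  exact: exprn_gt0.
by rewrite divr_ge0 ?sqr_ge0 ?ltW.
Qed.

(* At this scale the t^2 and t^4 terms of the power gap of t = |X| / c have the
   same mean m_2^2 / m_4, so that only m_b remains to be compared with m_2. *)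
Let c := Num.sqrt (m 4 / m 2).

Let c_gt0 : 0 < c.
Proof. by rewrite sqrtr_gt0 divr_gt0// fourth_moment_gt0. Qed.

Let c2 : c ^+ 2 = m 4 / m 2.
Proof. by rewrite sqr_sqrtr// divr_ge0 ?ltW// fourth_moment_gt0. Qed.

Let Rintegral_scaled_gap b : 0 <= b -> b < 2 ->
  \int[P]_t power_gap b (`|X t| / c) =
  2 * c ^- 2 * (c `^ (2 - b) * mabs b - m 2).
Proof.
move=> b0 b2; have [-> _] := Rintegral_power_gap X EX4 b c b0 b2 c_gt0.
rewrite powRB; last by rewrite (gt_eqF c_gt0) implybT.
rewrite powR_mulrn ?ltW//.
have -> : c ^- 4 * m 4 = c ^- 2 * m 2.
  have -> : m 4 = c ^+ 2 * m 2 by rewrite c2 divfK// gt_eqF.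
  by field; rewrite gt_eqF.
field; rewrite !gt_eqF// ?powR_gt0//.
Qed.

Lemma lyapunov b : 0 <= b -> b < 2 -> m 2 <= c `^ (2 - b) * mabs b.
Proof.
move=> b0 b2; rewrite -subr_ge0.
rewrite -(@pmulr_rge0 _ (2 * c ^- 2)) ?mulr_gt0 ?invr_gt0 ?exprn_gt0//.
rewrite -Rintegral_scaled_gap//; apply: Rintegral_ge0 => t _.
by rewrite power_gap_ge0// divr_ge0// ltW.
Qed.

Lemma lyapunov_eq_ae b : 0 <= b -> b < 2 -> m 2 = c `^ (2 - b) * mabs b ->
  {ae P, forall t, power_gap b (`|X t| / c) = 0}.
Proof.
move=> b0 b2 e; apply: Rintegral_eq0_ae.
- by have [_] := Rintegral_power_gap X EX4 b c b0 b2 c_gt0.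
- by move=> t; rewrite power_gap_ge0// divr_ge0// ltW.
- by rewrite Rintegral_scaled_gap// -e subrr mulr0.
Qed.

Lemma absolute_moment_gt0 b : 0 <= b -> b < 2 -> 0 < mabs b.
Proof.
move=> b0 b2; have := lt_le_trans m2_gt0 (lyapunov b b0 b2).
by rewrite pmulr_rgt0// powR_gt0.
Qed.

Let ratio b := m 2 `^ (b / (2 - b)) / mabs b `^ (2 / (2 - b)).

Let ratioE b : 0 <= b -> b < 2 ->
  ratio b = m 2 `^ (2 / (2 - b)) / (m 2 * mabs b `^ (2 / (2 - b))) /\
  m 4 / m 2 ^+ 2 = (c `^ (2 - b) * mabs b) `^ (2 / (2 - b)) /
     (m 2 * mabs b `^ (2 / (2 - b))).
Proof.
move=> b0 b2.
have [E1 E2] := lyapunov_ratioE _ _ _ _ _ b2 m2_gt0 c_gt0 (absolute_moment_gt0 _ b0 b2).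
by split=> //; rewrite -E2 c2; field; rewrite gt_eqF.
Qed.

Lemma moment_ratio_le b : 0 <= b -> b < 2 -> ratio b <= m 4 / m 2 ^+ 2.
Proof.
move=> b0 b2; have [-> ->] := ratioE b b0 b2.
rewrite ler_pM2r; last by rewrite invr_gt0 mulr_gt0// powR_gt0// absolute_moment_gt0.
apply: ge0_ler_powR.
- by rewrite divr_ge0// subr_ge0 ltW.
- by rewrite nnegrE ltW.
- by rewrite nnegrE mulr_ge0 ?powR_ge0// ltW// absolute_moment_gt0.
exact: lyapunov.
Qed.

(** The power gap vanishes almost everywhere, and its only zeros are 1 and, when
    b is nonzero, 0. *)
Lemma moment_ratio_eq_ae b : 0 <= b -> b < 2 -> ratio b = m 4 / m 2 ^+ 2 ->
  {ae P, forall t, X t = 0 /\ b != 0 \/ X t ^+ 2 = m 4 / m 2}.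
Proof.
move=> b0 b2; have [-> ->] := ratioE b b0 b2.
have D0 : 0 < m 2 * mabs b `^ (2 / (2 - b)).
  by rewrite mulr_gt0// powR_gt0// absolute_moment_gt0.
move=> /(mulIf _) E.
have {}E : m 2 = c `^ (2 - b) * mabs b.
  apply: (@powR_injective _ (2 / (2 - b))).
  - by rewrite divr_gt0// subr_gt0.
  - by rewrite nnegrE ltW.
  - by rewrite nnegrE mulr_ge0 ?powR_ge0// ltW// absolute_moment_gt0.
  - by apply: E; rewrite invr_eq0 gt_eqF.
have := lyapunov_eq_ae b b0 b2 E; apply: filterS => t gap0.
have [X0|X0] := eqVneq (X t) 0.
  left; split=> //; apply: contra_eq_neq gap0 => ->.
  by rewrite X0 normr0 mul0r /power_gap powRr0 !expr0n/= !mulr0 subr0 addr0 mulr1 pnatr_eq0.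
right; have [Xc|Xc] := eqVneq (`|X t| / c) 1.
  rewrite -c2 -(mul1r c) -Xc divfK ?gt_eqF// -normrX ger0_norm//.
  by rewrite exprn_even_ge0.
have := power_gap_gt0 b (`|X t| / c) b2 _ Xc.
by rewrite gap0 ltxx divr_gt0 ?normr_gt0// => /(_ isT).
Qed.

End centered.

(** * Centered symmetric Bernoulli variables *)

Section symmetric_bernoulli.
Context {d} {T : measurableType d} {R : realType} {P : probability T R}.
Variable X : {RV P >-> R}.
Hypothesis EX4 : ('E_P[fun t => (X t ^+ 4)%R] < +oo)%E.
Hypothesis EX0 : ('E_P[X] = 0)%E.

Local Notation m k := (\int[P]_t (X t ^+ k)).

Let m1 : m 1 = 0.
Proof. by rewrite -[LHS]fine_expectation EX0. Qed.

Hypothesis m2_gt0 : 0 < m 2.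

Lemma ae_sqr_eq_moments : {ae P, forall t, X t ^+ 2 = m 2} ->
  m 3 = 0 /\ m 4 = m 2 ^+ 2.
Proof.
move=> X2; split.
  have := ae_quartic_eq0 X EX4 0 1 0 (- m 2) 0.
  rewrite m1 => /(_ _)/= q; apply/eqP; rewrite -subr_eq0; apply/eqP.
  rewrite -[RHS]q; first by ring.
  by apply: filterS X2 => t X2; rewrite /quartic -[in - m 2]X2; ring.
apply/eqP; rewrite -subr_eq0; apply/eqP.
have := ae_quartic_eq0 X EX4 1 0 0 0 (- m 2 ^+ 2).
move=> q; rewrite -[RHS]q; first by ring.
by apply: filterS X2 => t X2; rewrite /quartic -[in - m 2 ^+ 2]X2; ring.
Qed.

(** On the support {a, b} both (X-a)(X-b) and X(X-a)(X-b) vanish; their means are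
    m_2 + ab and m_3 - (a+b) m_2. With m_3 = 0 these give b = -a and a^2 = m_2. *)
Lemma symmetric_bernoulli_ae_sqr : symmetric_bernoulli_rv X ->
  {ae P, forall t, X t ^+ 2 = m 2}.
Proof.
move=> [[a [b [_ suppX]]]]; rewrite EX0/= => /(congr1 fine).
rewrite fine_expectation/=; under eq_Rintegral do rewrite subr0.
move=> m3.
have Xab : {ae P, forall t, (X t - a) * (X t - b) = 0}.
  apply: filterS (ae_rv_support X) => t.
  by rewrite suppX/= => -[|] ->; rewrite subrr ?mul0r ?mulr0.
have e2 : m 2 + a * b = 0.
  rewrite -[RHS](ae_quartic_eq0 X EX4 0 0 1 (- (a + b)) (a * b)).
    by rewrite m1; ring.
  by apply: filterS Xab => t e; rewrite -[RHS]e /quartic; ring.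
have e3 : (a + b) * m 2 = 0.
  rewrite -[RHS]oppr0 -[in RHS](ae_quartic_eq0 X EX4 0 1 (- (a + b)) (a * b) 0).
    by rewrite m1 m3; ring.
  apply: filterS Xab => t e.
  by rewrite -[RHS](mulr0 (X t)) -[X in _ = _ * X]e /quartic; ring.
have ab : b = - a.
  by apply/eqP; rewrite -addr_eq0 addrC; move/eqP: e3; rewrite mulf_eq0 (gt_eqF m2_gt0) orbF.
apply: filterS Xab => t; rewrite ab => e; apply/eqP; rewrite -subr_eq0.
move: e2; rewrite ab => e2; apply/eqP.
by rewrite -[RHS]e -[RHS]subr0 -[in RHS]e2; ring.
Qed.

(** Both square roots of m_2 belong to the support: if the law of X missed a
    neighbourhood of one of them, X would be almost surely equal to the other, which
    is nonzero, against E[X] = 0. *)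
Lemma ae_sqr_symmetric_bernoulli :
  {ae P, forall t, X t ^+ 2 = m 2} -> symmetric_bernoulli_rv X.
Proof.
move=> X2; have [m3 _] := ae_sqr_eq_moments X2.
have X3 : ('E_P[fun t => ((X t - fine 'E_P[X]) ^+ 3)%R] = 0)%E.
  rewrite EX0/=; under eq_fun do rewrite subr0.
  have i3 : P.-integrable setT (EFin \o (fun t => X t ^+ 3)).
    have := integrable_quartic X EX4 0 1 0 0 0; apply: eq_integrable => // t _.
    by rewrite /= /quartic; congr EFin; ring.
  rewrite unlock -[LHS]fineK; last exact: integrable_fin_num i3.
  by congr EFin; exact: m3.
split=> //; pose r := Num.sqrt (m 2).
have r0 : 0 < r by rewrite sqrtr_gt0.
have r2 : r ^+ 2 = m 2 by rewrite sqr_sqrtr// ltW.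
have Xr : {ae P, forall t, X t = r \/ X t = - r}.
  apply: filterS X2 => t; rewrite -r2 => /eqP; rewrite eqf_sqr.
  by case/orP => /eqP; [left|right].
have Xneq x : x != 0 -> {ae P, forall t, X t = x} -> False.
  move=> x0 Xx; have := ae_quartic_eq0 X EX4 0 0 0 1 (- x).
  rewrite m1 !mul0r mulr0 !add0r => e; move/eqP: x0; apply.
  apply: oppr_inj; rewrite oppr0; apply: e; apply: filterS Xx => t ->.
  by rewrite /quartic; ring.
exists r, (- r); split; first by rewrite gt_eqF// gtrN.
apply/seteqP; split => x.
  apply: contraPP => xr; apply/notin_rv_support.
  exists (~` [set r; - r]); split=> //.
    by apply: closed_openC; apply: closedU; exact: closed_eq.
  by apply: filterS Xr => t Xt /=; exact.
move=> xr; apply: contrapT => /notin_rv_support[U [_ Ux XU]].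
apply: (Xneq (- x)).
  by case: xr => ->; rewrite ?opprK ?oppr_eq0 gt_eqF.
apply: filterS2 Xr XU => t; case: xr Ux => -> Ux [] -> // nU; by rewrite opprK.
Qed.

End symmetric_bernoulli.

(** * The inequality and its case of equality *)

(* For alpha = 1 every centered Bernoulli X attains equality, and for alpha = 0
   and 0 < beta so does every X uniform on {-1, 1} given X <> 0; "equality only
   for symmetric Bernoulli X" is therefore asserted for all other parameters. *)
Theorem lemma2 (d : measure_display) (T : measurableType d) (R : realType)
    (P : probability T R) (X : {RV P >-> R}) (alpha beta : R)
    (beta_ge0 : 0 <= beta) (beta_lt2 : beta < 2)
    (alpha_ge0 : 0 <= alpha) (alpha_le1 : alpha <= 1)
    (EX0 : ('E_P[X] = 0)%E)
    (EX2 : (0 < 'E_P[fun t => (X t ^+ 2)%R])%E)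
    (EX4 : ('E_P[fun t => (X t ^+ 4)%R] < +oo)%E) :
  [/\ alpha <= moment_gap X alpha beta,
      symmetric_bernoulli_rv X -> moment_gap X alpha beta = alpha
    & alpha < 1 -> 0 < alpha \/ beta = 0 ->
      moment_gap X alpha beta = alpha -> symmetric_bernoulli_rv X].
Proof.
have m1 : \int[P]_t (X t ^+ 1) = 0 by rewrite -[LHS]fine_expectation EX0.
set m2 := \int[P]_t (X t ^+ 2); set m3 := \int[P]_t (X t ^+ 3).
set m4 := \int[P]_t (X t ^+ 4); set mb := \int[P]_t (`|X t| `^ beta).
have m2_gt0 : 0 < m2.
  have i2 : P.-integrable setT (EFin \o (fun t => X t ^+ 2)).
    have := integrable_quartic X EX4 0 0 1 0 0; apply: eq_integrable => // t _.
    by rewrite /= /quartic; congr EFin; ring.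
  by rewrite -lte_fin fineK; [move: EX2; rewrite unlock|exact: integrable_fin_num i2].
have mb_gt0 : 0 < mb := absolute_moment_gt0 X EX4 m1 m2_gt0 beta beta_ge0 beta_lt2.
pose K := m4 / m2 ^+ 2.
pose S := m3 ^+ 2 / m2 ^+ 3.
pose L := m2 `^ (beta / (2 - beta)) / mb `^ (2 / (2 - beta)).
have gapE : moment_gap X alpha beta - alpha =
    alpha * (K - S - 1) + (1 - alpha) * (K - L).
  rewrite /moment_gap !fine_expectation -/m2 -/m3 -/m4 -/mb.
  rewrite (gtr0_norm m2_gt0) (gtr0_norm mb_gt0) -normrX ger0_norm ?sqr_ge0//.
  by rewrite -/K -/S -/L; ring.
have K_pearson : K - S - 1 = (m4 - (m2 ^+ 2 + m3 ^+ 2 / m2)) / m2 ^+ 2.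
  by rewrite /K /S; field; rewrite gt_eqF.
have pearson_ge0 : 0 <= K - S - 1.
  rewrite K_pearson divr_ge0 ?sqr_ge0// subr_ge0.
  exact: (skewness_le_kurtosis X EX4 m1 m2_gt0).
have lyapunov_ge0 : 0 <= K - L.
  by rewrite subr_ge0; exact: (moment_ratio_le X EX4 m1 m2_gt0).
split.
- by rewrite -subr_ge0 gapE addr_ge0// mulr_ge0// subr_ge0.
- move=> /(symmetric_bernoulli_ae_sqr X EX4 EX0 m2_gt0) X2.
  have [m3E m4E] := ae_sqr_eq_moments X EX4 EX0 X2.
  apply/eqP; rewrite -subr_eq0 gapE.
  have -> : S = 0 by rewrite /S /m3 m3E expr0n/= mul0r.
  have -> : K = 1 by rewrite /K /m4 m4E divff// expf_neq0// gt_eqF.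
  suff -> : L = 1 by rewrite !subrr subr0 subrr !mulr0 addr0.
  have mbE : mb = m2 `^ (beta / 2).
    rewrite -[RHS](@Rintegral_probability_cst _ _ _ P); apply: ae_eq_Rintegral => //.
      apply: (measurableT_comp (measurable_powR beta)).
      exact: measurableT_comp.
    apply: filterS X2 => t X2.
    rewrite mulrC powRrM powR12_sqrt ?ltW//; congr (_ `^ _).
    by rewrite /m2 -X2 sqrtr_sqr.
  rewrite /L mbE -powRrM.
  have -> : beta / 2 * (2 / (2 - beta)) = beta / (2 - beta).
    by field; rewrite subr_eq0 gt_eqF.
  by rewrite divff// gt_eqF// powR_gt0.
- move=> alpha_lt1 ab /eqP; rewrite -subr_eq0 gapE.
  rewrite paddr_eq0 ?mulr_ge0// ?subr_ge0// !mulf_eq0 !subr_eq0.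
  rewrite (gt_eqF alpha_lt1)/= => /andP[pearson_eq /eqP KL].
  have Xc := moment_ratio_eq_ae X EX4 m1 m2_gt0 beta beta_ge0 beta_lt2 (esym KL).
  have {}Xc : {ae P, forall t, X t ^+ 2 = m4 / m2}.
    (* The value 0 is excluded by Pearson's relation X^2 - (m_3/m_2) X = m_2 if
       alpha > 0, and by 0^0 = 1 if beta = 0. *)
    case: ab => [a0|b0].
      have {}pearson_eq : m4 = m2 ^+ 2 + m3 ^+ 2 / m2.
        move: pearson_eq; rewrite gt_eqF//= -subr_eq0 K_pearson mulf_eq0.
        by rewrite invr_eq0 sqrf_eq0 (gt_eqF m2_gt0) orbF subr_eq0 => /eqP.
      have := skewness_eq_kurtosis_ae X EX4 m1 m2_gt0 pearson_eq.
      apply: filterS2 Xc => t [[-> _]|->//].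
      rewrite expr0n/= mulr0 subr0 sub0r => /eqP.
      by rewrite oppr_eq0 gt_eqF.
    by apply: filterS Xc => t [[_]|//]; rewrite b0 eqxx.
  apply: ae_sqr_symmetric_bernoulli => //; apply: filterS (Xc) => t ->.
  apply/esym/eqP; rewrite -subr_eq0 -/m2; apply/eqP.
  rewrite -[RHS](ae_quartic_eq0 X EX4 0 0 1 0 (- (m4 / m2))) -/m2.
    by ring.
  by apply: filterS Xc => s <-; rewrite /quartic; ring.
Qed.
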